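(* For integers $m\ge1$, $n\ge2$ and real $\alpha\notin\pi\mathbb{Z}$, $$\sum_{k=0}^{n-1}\cot^m\frac{\alpha+k\pi}{n}=(-1)^{m/2}\,n\,\mathbb{1}_{m\text{ even}}+\frac{(-i)^m}{(m-1)!}\sum_{\nu\in\mathcal{P}^{\mathrm{odd}}(m)}P_{|\nu|-1}(\cot\alpha)\,(in)^{|\nu|}\,\mu(\hat0_m,\nu).$$
   Context: The derivative polynomials $P_k$ are defined by $P_0(x)=x$, $P_{k+1}(x)=(1+x^2)P_k'(x)$; equivalently $\frac{d^k}{dz^k}\tan z=P_k(\tan z)$ (and $\frac{d^k}{dz^k}\cot z=(-1)^kP_k(\cot z)$). $\mathcal{P}^{\mathrm{odd}}(m)$ is the set of set partitions of $\{1,\dots,m\}$ all of whose blocks have odd cardinality; $|\nu|$ is the number of blocks of $\nu$; and $\mu(\hat0_m,\nu)=\prod_{B\in\nu}(-1)^{|B|-1}(|B|-1)!$ (the Möbius function of the partition lattice). $\mathbb{1}_{m\text{ even}}$ is $1$ if $m$ is even and $0$ otherwise. *)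

(* Defs.v *)
From HB Require Import structures.
From mathcomp Require Import all_boot all_order all_algebra.
From mathcomp Require Import reals trigo.
From mathcomp Require Import complex.
Set Implicit Arguments. Unset Strict Implicit. Unset Printing Implicit Defensive.
Import Order.TTheory GRing.Theory Num.Theory.
Local Open Scope ring_scope.

Definition cot (R : realType) (x : R) : R := cos x / sin x.

Fixpoint derpoly (R : nzRingType) (k : nat) : {poly R} :=
  match k with
  | 0 => 'X
  | k'.+1 => (1 + 'X ^+ 2) * (derpoly R k')^`()
  end.

Definition odd_set_partition (m : nat) (nu : {set {set 'I_m}}) : bool :=
  partition nu [set: 'I_m] && [forall B in nu, odd #|B|].

(* Möbius function mu(0_m, nu) of the partition lattice, in a ring R *)
Definition mobius_part (R : nzRingType) (m : nat) (nu : {set {set 'I_m}}) : R :=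
  \prod_(B in nu) ((-1) ^+ (#|B|.-1) * (#|B|.-1)`!%:R).

(* Main.v *)
(** Write [T_m] for the cotangent power sum as a function of [alpha].  As
    [cot' = - (1 + cot^2)], differentiating [T_(m+1)] gives
    [T_(m+2) = n / (m+1) (1 + X^2) T_(m+1)' - T_m] as polynomials in
    [X = cot alpha], and [T_1 = n cot alpha] by Vieta.  On the other side,
    [sum_nu f |nu| prod_(B in nu) (|B|-1)!] over the odd partitions of an
    [m]-set, computed by removing the block of a given element, satisfies
    [A_(m+2) f = A_(m+1) (f o succ) + m (m+1) A_m f].  For
    [f j = (i n)^j P_(j-1)] the shift [f o succ] is [i n (1 + X^2) d/dX], so
    both sides obey the same recurrence, the parity term accounting for
    [T_0 = n]. *)
Require Import Defs.
From HB Require Import structures.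
From mathcomp Require Import all_boot all_order all_algebra.
From mathcomp Require Import functions reals topology normedtype derive realfun.
From mathcomp Require Import trigo complex.
From mathcomp Require Import zify ring.
Import Order.TTheory GRing.Theory Num.Theory.
Import numFieldNormedType.Exports.
Local Open Scope ring_scope.

(** * Weighted sums over set partitions into odd blocks *)

Section OddPartitions.
Variable V : nmodType.
Implicit Types f : nat -> V.

(* For [f j = y^j] the exponential generating function is [F = exp (y artanh x)];
   the recurrence encodes [(1 - x^2) F' = y F]. *)
Fixpoint oddpart_rec (m : nat) f : V :=
  match m with
  | 0 => f 0
  | m1.+1 => match m1 with
    | 0 => f 1
    | m0.+1 => oddpart_rec m1 (f \o succn) + oddpart_rec m0 f *+ (m0 * m0.+1)
    end
  end.

Arguments oddpart_rec : simpl never.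

Lemma oddpart_recSS m f : oddpart_rec m.+2 f =
  oddpart_rec m.+1 (f \o succn) + oddpart_rec m f *+ (m * m.+1).
Proof. by []. Qed.

Lemma oddpart_rec_ffact m f : oddpart_rec m.+1 f =
  \sum_(k < m.+1 | ~~ odd k) oddpart_rec (m - k) (f \o succn) *+ (m ^_ k).
Proof.
elim/ltn_ind: m => -[|[|m]] IH.
- by rewrite big_mkcond /= big_ord1.
- rewrite big_mkcond /= !big_ord_recl big_ord0 /=.
  by rewrite oddpart_recSS mul0n mulr0n !addr0 mulr1n.
rewrite oddpart_recSS big_mkcond 2!big_ord_recl /= ffactn0 mulr1n add0r.
congr (_ + _); rewrite (IH m) //.
rewrite -sumrMnl big_mkcond /=.
apply: eq_bigr => k _.
rewrite /= !negbK; case: ifP => // _.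
rewrite /bump !add1n -mulrnA !ffactSS !subSS; congr (_ *+ _); lia.
Qed.

Variable T : finType.
Implicit Types (D B C : {set T}) (P : {set {set T}}).

Definition odd_partition D P := partition P D && [forall B in P, odd #|B|].

(** The left side is the condition produced by [reindex_onto] for the maps adding and removing the
    block [B]; its last conjunct forces [B] not to be in [P]. *)
Lemma odd_partitionU1 D B P (x : T) : x \in D -> x \in B ->
  [&& odd_partition D (B |: P), pblock (B |: P) x == B & (B |: P) :\ B == P]
  = [&& B \subset D, odd #|B| & odd_partition (D :\: B) P].
Proof.
move=> xD xB; have B0 : B != set0 by apply/set0Pn; exists x.
apply/and3P/and3P=> -[].
  move=> /andP[pP /forall_inP oP] _ /eqP eP.
  have BP : B \in B |: P by rewrite setU11.
  split.
  - by rewrite -(cover_partition pP); apply: bigcup_sup.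
  - exact: oP.
  apply/andP; split; first by rewrite -eP; apply: partitionD1.
  by apply/forall_inP => C CP; apply: oP; rewrite inE CP orbT.
move=> BD oB /andP[pP /forall_inP oP].
have dj : [disjoint B & D :\: B] by rewrite -setI_eq0 setIDA setIC -setIDA setDv setI0.
have BnP : B \notin P.
  apply/negP => BP; have := partitionS pP BP => /subsetP/(_ _ xB).
  by rewrite inE xB.
have pBP := partitionU1 pP B0 dj.
have eD : B :|: (D :\: B) = D.
  apply/setP=> y; rewrite !inE.
  by case: (boolP (y \in B)) => //= /(subsetP BD).
rewrite eD in pBP.
split.
- rewrite /odd_partition pBP; apply/forall_inP => C; rewrite !inE.
  by case/orP=> [/eqP->//|]; apply: oP.
- apply/eqP; apply: def_pblock => //; last by rewrite setU11.
  by case/and3P: pBP.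
- by apply/eqP; apply: setU1K.
Qed.

(** Partitions are grouped by the block [B] of [x]. Removing [B] lowers the number of blocks by one,
    hence [f \o succn], and takes out the weight of [B]. *)
Lemma sum_odd_partition_block D (x : T) f : x \in D ->
  \sum_(P | odd_partition D P) f #|P| *+ \prod_(B in P) (#|B|.-1)`! =
  \sum_(B : {set T} | [&& x \in B, B \subset D & odd #|B|])
    (\sum_(P | odd_partition (D :\: B) P)
       (f \o succn) #|P| *+ \prod_(C in P) (#|C|.-1)`!) *+ (#|B|.-1)`!.
Proof.
move=> xD.
rewrite (partition_big (fun P => pblock P x)
  (fun B : {set T} => [&& x \in B, B \subset D & odd #|B|])) /=; last first.
  move=> P /andP[pP /forall_inP oP].
  have xc : x \in cover P by rewrite (cover_partition pP).
  have BP := pblock_mem xc.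
  by rewrite mem_pblock xc oP // andbT (partitionS pP BP).
apply: eq_bigr => B /and3P[xB BD oB].
rewrite (reindex_onto (fun P => B |: P) (fun P => P :\ B)) /=; last first.
  move=> P /andP[/andP[pP _] /eqP eB]; apply: setD1K.
  by rewrite -eB pblock_mem // (cover_partition pP).
rewrite -sumrMnl; apply: eq_big => [P|P].
  by rewrite -andbA (odd_partitionU1 _ _ _ _ xD xB) BD oB.
rewrite -andbA (odd_partitionU1 _ _ _ _ xD xB) => /and3P[_ _ /andP[pP _]].
have BnP : B \notin P.
  apply/negP => BP; have := partitionS pP BP => /subsetP/(_ _ xB).
  by rewrite inE xB.
by rewrite cardsU1 BnP big_setU1 //= mulnC mulrnA.
Qed.

Lemma sum_subsets_card D (g : nat -> V) :
  \sum_(C : {set T} | (C \subset D) && ~~ odd #|C|) g #|C| =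
  \sum_(k < #|D|.+1 | ~~ odd k) g k *+ 'C(#|D|, k).
Proof.
rewrite (partition_big (fun C : {set T} => inord #|C| : 'I_#|D|.+1)
  (fun k => ~~ odd k)) /=; last first.
  by move=> C /andP[CD oC]; rewrite inordK // ltnS subset_leq_card.
apply: eq_bigr => k ek; rewrite -(cards_draws D k) -sumr_const.
apply: eq_big => [C|C /andP[/andP[CD _] /eqP <-]].
  rewrite inE; case: (boolP (C \subset D)) => //= CD.
  rewrite -val_eqE /= inordK ?ltnS ?subset_leq_card //.
  by case: eqP => [->|]; rewrite ?andbF ?ek.
by rewrite inordK // ltnS subset_leq_card.
Qed.

Lemma sum_odd_partition D f :
  \sum_(P | odd_partition D P) f #|P| *+ \prod_(B in P) (#|B|.-1)`! =
  oddpart_rec #|D| f.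
Proof.
have [N] := ubnP #|D|; elim: N => // N IH in D f *; rewrite ltnS => cD.
have [->|[x xD]] := set_0Vmem D.
  rewrite cards0 /= (big_pred1 set0) => [|P]; first by rewrite cards0 big_set0.
  rewrite /odd_partition partition_set0 /=; case: eqP => //= ->.
  by apply/forall_inP => B; rewrite inE.
rewrite (sum_odd_partition_block _ _ _ xD).
have cDx := cardsD1 x D; rewrite xD add1n in cDx.
rewrite cDx oddpart_rec_ffact.
(* The block of [x] is written [x |: C]: [C] has even size and [#|C|]! is the weight of the
   block. *)
transitivity (\sum_(C : {set T} | (C \subset D :\ x) && ~~ odd #|C|)
    oddpart_rec (#|D :\ x| - #|C|) (f \o succn) *+ #|C|`!); last first.
  pose g k := oddpart_rec (#|D :\ x| - k) (f \o succn) *+ k`!.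
  rewrite (sum_subsets_card _ g).
  by apply: eq_bigr => k _; rewrite -mulrnA mulnC bin_ffact.
rewrite (reindex_onto (fun C : {set T} => x |: C) (fun B => B :\ x)) /=; last first.
  by move=> B /and3P[xB _ _]; apply: setD1K.
apply: eq_big => C.
  rewrite setU11 /= subUset sub1set xD /= subsetD1 cardsU1.
  case: (boolP (x \in C)) => [xC|xC] /=; last first.
    by rewrite add0n setU1K // eqxx !andbT.
  rewrite !andbF; apply/negbTE/negP => /andP[_ /eqP/setP/(_ x)].
  by rewrite !inE eqxx xC.
case/andP=> /and3P[_ xCD _] /eqP eC.
have xC : x \notin C by rewrite -eC !inE eqxx.
have cC : #|x |: C| = #|C|.+1 by rewrite cardsU1 xC.
have cDC : #|D :\: (x |: C)| = (#|D :\ x| - #|C|)%N.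
  by rewrite cardsD (setIidPr xCD) cC cDx subSS.
by rewrite cC /= -cDC -IH // cDC; lia.
Qed.

End OddPartitions.

Arguments oddpart_rec {V} m f : simpl never.

(** * Cotangent power sums as polynomials in [cot a] *)

Section CotSums.
Variable R : realType.
Implicit Types (x a : R) (n m : nat).

(* Real and imaginary parts of [('X + i)^n]. *)
Fixpoint cosin_poly n : {poly R} * {poly R} :=
  if n is n'.+1 then
    let: (p, q) := cosin_poly n' in ('X * p - q, 'X * q + p)
  else (1, 0).

(** De Moivre: [(cot x + i) sin x = cos x + i sin x]. *)
Lemma horner_cosin_poly n x : sin x != 0 ->
  (cosin_poly n).1.[cot x] * sin x ^+ n = cos (x *+ n) /\
  (cosin_poly n).2.[cot x] * sin x ^+ n = sin (x *+ n).
Proof.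
move=> sx; elim: n => [|n]; first by rewrite !hornerE !mulr0n sin0 cos0.
rewrite /=; case: (cosin_poly n) => p q /= [IHp IHq].
rewrite mulrS cosD sinD -IHp -IHq hornerD hornerN !(hornerM, hornerD, hornerX) exprS.
have -> : cos x = cot x * sin x by rewrite /cot divfK.
by split; ring.
Qed.

Lemma cosin_poly_coef n k :
  [/\ (n <= k.+1)%N -> (cosin_poly n).1`_k = (k == n)%:R &
      (n <= k.+2)%N -> (cosin_poly n).2`_k = n%:R *+ (k.+1 == n)].
Proof.
elim: n k => [|n IH] k.
  by split => _; rewrite /= ?coef1 ?coef0 ?mul0rn.
have Hp k' := (IH k').1; have Hq k' := (IH k').2.
move: Hp Hq; rewrite /=; case: (cosin_poly n) => p q /= Hp Hq.
split => nk; rewrite coefD ?coefN coefXM.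
- rewrite Hq; last by lia.
  have -> : (k.+1 == n) = false by lia.
  case: k nk => [|k] nk /=; first by rewrite subr0.
  by rewrite Hp ?subr0 // eqSS.
- rewrite Hp; last by lia.
  case: k nk => [|k] nk /=.
    by rewrite add0r; case: n {IH Hp Hq nk} => [|n].
  rewrite Hq // !eqSS; case: eqP => [<-|_]; last by rewrite addr0.
  by rewrite mulr1n natr1 mulr1n.
Qed.

Lemma sinM_int (z : int) : sin (z%:~R * pi) = 0 :> R.
Proof.
have sn n : sin (n%:R * pi) = 0 :> R.
  by rewrite mulr_natl -[_ *+ _]add0r (alternatingn (@sinDpi R)) sin0 mulr0.
case: (intP z) => [|n|n];
  by rewrite ?mulrNz ?mulNr ?sinN -?pmulrn ?sn ?mul0r ?sin0 ?oppr0.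
Qed.

Lemma sin_neq0 a : (forall z : int, a != z%:~R * pi) -> sin a != 0.
Proof.
move=> az; have pi0 := pi_gt0 R.
(* Subtracting [z * pi] brings [a] into the open interval from 0 to [pi], where the sine is
   positive. *)
set z := Num.floor (a / pi).
have /andP[za az1] : z%:~R * pi <= a < (z + 1)%:~R * pi.
  by rewrite -ler_pdivlMr // -ltr_pdivrMr // floor_le_tmp floorD1_gt.
have h : 0 < a - z%:~R * pi < pi.
  rewrite subr_gt0 lt_neqAle eq_sym az za /= ltrBlDr.
  by move: az1; rewrite intrD mulrDl mul1r addrC.
have := sin_gt0_pi h; rewrite sinB sinM_int mulr0 subr0.
by apply: contraTneq => ->; rewrite mul0r ltxx.
Qed.

Lemma sin_mulrn_eq0 x n : sin x = 0 -> sin (x *+ n) = 0.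
Proof.
move=> s0; elim: n => [|n IH]; first by rewrite mulr0n sin0.
by rewrite mulrS sinD s0 IH mulr0 mul0r addr0.
Qed.

Lemma cosM_nat_neq0 n : cos (n%:R * pi) != 0 :> R.
Proof.
apply/eqP => c0; have := cos2Dsin2 (n%:R * pi : R).
rewrite c0 (sinM_int n%:Z) expr0n addr0 => /eqP.
by rewrite eq_sym oner_eq0.
Qed.

(** A zero of the sine stays one after multiplication by [n], but
    [sin (a + k pi) = sin a * cos (k pi)] is nonzero. *)
Lemma sin_shift_neq0 n a (k : nat) : (0 < n)%N -> sin a != 0 ->
  sin ((a + k%:R * pi) / n%:R) != 0.
Proof.
move=> n0; apply: contraNneq => s0; have := @sin_mulrn_eq0 _ n s0.
have nR : n%:R != 0 :> R by rewrite pnatr_eq0 -lt0n.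
rewrite -[_ *+ n]mulr_natr divfK // sinD (sinM_int k%:Z) mulr0 addr0 => /eqP.
by rewrite mulf_eq0 (negbTE (cosM_nat_neq0 k)) orbF.
Qed.

(* The [n] values are the distinct roots of the monic polynomial
   [C_n - cot a * S_n], where [C_n, S_n = cosin_poly n]; read off their sum
   from the coefficient of degree [n - 1]. *)
Lemma sum_cot n a : (0 < n)%N -> sin a != 0 ->
  \sum_(k < n) cot ((a + k%:R * pi) / n%:R) = n%:R * cot a.
Proof.
move=> n0 sa.
pose t (k : 'I_n) := (a + k%:R * pi) / n%:R.
have nR : n%:R != 0 :> R by rewrite pnatr_eq0 -lt0n.
have tn k : t k *+ n = a + k%:R * pi by rewrite -mulr_natr divfK.
have snk k : sin (k%:R * pi) = 0 :> R by have := sinM_int k%:Z.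
have st k : sin (t k) != 0 by apply: sin_shift_neq0.
pose p := (cosin_poly n).1 - cot a *: (cosin_poly n).2.
pose rs := [seq cot (t k) | k <- enum 'I_n].
have pn k : (n <= k)%N -> p`_k = (k == n)%:R.
  move=> nk; rewrite coefB coefZ.
  rewrite (cosin_poly_coef _ _).1 ?(cosin_poly_coef _ _).2; try lia.
  by rewrite (_ : (k.+1 == n) = false) ?mulr0n ?mulr0 ?subr0 //; lia.
have sp : size p = n.+1.
  apply/eqP; rewrite eqn_leq; apply/andP; split.
    by apply/leq_sizeP => j nj; rewrite pn ?gtn_eqF //; lia.
  rewrite ltnNge; apply/negP => /leq_sizeP/(_ n (leqnn n))/eqP.
  by rewrite pn // eqxx oner_eq0.
have lp : lead_coef p = 1 by rewrite lead_coefE sp pn //= eqxx.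
have pr : all (root p) rs.
  apply/allP => _ /mapP[k _ ->]; rewrite rootE.
  have [h1 h2] := horner_cosin_poly n _ (st k).
  (* Multiplied by [sin (t k) ^+ n], the value of [p] becomes [cos (n t_k) - cot a * sin (n t_k)],
     which vanishes as [n t_k = a + k pi]. *)
  rewrite -(inj_eq (mulIf (expf_neq0 n (st k)))) mul0r /p.
  rewrite hornerD hornerN hornerZ mulrBl -mulrA h1 h2.
  rewrite tn cosD sinD snk !mulr0 subr0 addr0 /cot; apply/eqP; field.
  exact: sa.
have ct (i j : 'I_n) : (i < j)%N -> cot (t i) != cot (t j).
  move=> ij; rewrite -subr_eq0.
  (* The numerator is positive because [0 < t j - t i < pi]. *)
  have -> : cot (t i) - cot (t j) = sin (t j - t i) / (sin (t j) * sin (t i)).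
    by rewrite sinB /cot; field; rewrite !st.
  apply: mulf_neq0; last by rewrite invr_eq0 mulf_neq0.
  apply: lt0r_neq0; apply: sin_gt0_pi.
  have -> : t j - t i = (j - i)%:R / n%:R * pi.
    by rewrite natrB ?(ltnW ij) // /t; field.
  have nR0 : 0 < n%:R :> R by rewrite ltr0n.
  rewrite mulr_gt0 ?pi_gt0 ?divr_gt0 ?ltr0n ?subn_gt0 //= gtr_pMl ?pi_gt0 //.
  by rewrite ltr_pdivrMr // mul1r ltr_nat (leq_ltn_trans (leq_subr _ _)).
have ur : uniq rs.
  rewrite map_inj_uniq ?enum_uniq // => i j /eqP cij; apply: val_inj => /=.
  case: (ltngtP i j) => // [/ct|/ct]; first by rewrite cij.
  by rewrite eq_sym cij.
have sr : size rs = n by rewrite size_map size_enum_ord.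
have := all_roots_prod_XsubC _ pr; rewrite sp sr uniq_rootsE => /(_ erefl ur).
rewrite lp scale1r => /(congr1 (fun q : {poly R} => q`_n.-1)).
have := @coefPn_prod_XsubC _ rs; rewrite sr => ->; last by rewrite -lt0n.
rewrite coefB coefZ (cosin_poly_coef _ _).1 ?(cosin_poly_coef _ _).2; try lia.
rewrite prednK // eqxx (_ : (n.-1 == n) = false) ?sub0r; last by lia.
by move/oppr_inj; rewrite big_map big_enum /= mulr1n mulrC => ->.
Qed.

Fixpoint cotpow_poly n m : {poly R} :=
  match m with
  | 0 => n%:R%:P
  | m1.+1 => match m1 with
    | 0 => n%:R *: 'X
    | m0.+1 =>
      (n%:R / m1%:R) *: ((1 + 'X^2) * (cotpow_poly n m1)^`()) - cotpow_poly n m0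
    end
  end.
Arguments cotpow_poly : simpl never.

Lemma cotpow_polySS n m : cotpow_poly n m.+2 =
  (n%:R / m.+1%:R) *: ((1 + 'X^2) * (cotpow_poly n m.+1)^`()) - cotpow_poly n m.
Proof. by []. Qed.

Lemma is_derive_cot x : sin x != 0 -> is_derive x 1 (@cot R) (- (1 + cot x ^+ 2)).
Proof.
move=> sx.
apply: trigger_derive.
by rewrite /cot /GRing.scale /=; field.
Qed.

Lemma sum_cot_pow n m a : (0 < n)%N -> sin a != 0 ->
  \sum_(k < n) cot ((a + k%:R * pi) / n%:R) ^+ m = (cotpow_poly n m).[cot a].
Proof.
move=> n0; have nR : n%:R != 0 :> R by rewrite pnatr_eq0 -lt0n.
elim/ltn_ind: m a => -[|[|m]] IH a sa.
- rewrite (eq_bigr (fun=> 1)) => [|k _]; last by rewrite expr0.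
  by rewrite sumr_const card_ord hornerC.
- rewrite hornerZ hornerX -sum_cot //; by apply: eq_bigr => k _; rewrite expr1.
pose t (k : nat) (b : R) := (b + k%:R * pi) / n%:R.
have dt k : is_derive a 1 (t k) n%:R^-1.
  by apply: is_derive_eq; rewrite /GRing.scale /= !mulr0 add0r addr0 mulr1.
pose c k := cot (t k a).
have dk (k : 'I_n) : is_derive a 1 (fun b => cot (t k b) ^+ m.+1)
    ((m.+1%:R * c k ^+ m) *: (- (1 + c k ^+ 2) * n%:R^-1)).
  have dc : is_derive a 1 (@cot R \o t k) (- (1 + c k ^+ 2) * n%:R^-1).
    apply: is_derive1_comp (dt k).
    by apply: is_derive_cot; apply: sin_shift_neq0.
  by have := is_deriveX m.+1 dc; rewrite exprfctE.
have dl : is_derive a 1 (fun b => \sum_(k < n) cot (t k b) ^+ m.+1)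
    (\sum_(k < n) (m.+1%:R * c k ^+ m) *: (- (1 + c k ^+ 2) * n%:R^-1)).
  by have := is_derive_sum dk; rewrite fct_sumE.
have dr : is_derive a 1 (horner (cotpow_poly n m.+1) \o @cot R)
   ((cotpow_poly n m.+1)^`().[cot a] * - (1 + cot a ^+ 2)).
  by apply: is_derive1_comp; apply: is_derive_cot.
(* The induction hypothesis holds wherever the sine is nonzero, thus on a neighbourhood of [a] by
   continuity, so both sides may be differentiated at [a]. *)
have nr : \near a, (horner (cotpow_poly n m.+1) \o @cot R) a =
   \sum_(k < n) cot (t k a) ^+ m.+1.
  near=> b; rewrite /= -IH //; near: b.
  exact: (cvgr_neq0 _ (@continuous_sin R a) sa).
have dr' := near_eq_is_derive nr dr.
have := @derive_val _ _ _ _ _ _ _ dl.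
rewrite (@derive_val _ _ _ _ _ _ _ dr') => e.
rewrite cotpow_polySS hornerD hornerN hornerZ hornerM hornerD hornerC hornerXn.
rewrite -(IH m) //.
(* Equality of the two derivatives; the summands [c k ^+ m] add up to the previous power sum and
   cancel against the subtracted term. *)
have -> : (1 + cot a ^+ 2) * (cotpow_poly n m.+1)^`().[cot a] =
   \sum_(k < n) (m.+1%:R / n%:R * (c k ^+ m + c k ^+ m.+2)).
  apply: oppr_inj; rewrite mulrC -mulrN e -sumrN; apply: eq_bigr => k _.
  rewrite /GRing.scale /= !exprS; field.
  exact: nR.
rewrite -mulr_sumr mulrA.
have -> : n%:R / m.+1%:R * (m.+1%:R / n%:R) = 1 :> R.
  by rewrite mulrA divfK ?divff // pnatr_eq0.
by rewrite mul1r big_split /= addrAC subrr add0r.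
Unshelve. all: by end_near.
Qed.

End CotSums.

Arguments cotpow_poly {R} n m : simpl never.

(** * Matching the two recurrences *)

Lemma raddf_oddpart_rec (V W : nmodType) (L : {additive V -> W}) m f :
  L (oddpart_rec m f) = oddpart_rec m (L \o f).
Proof.
move: f; elim/ltn_ind: m => -[|[|m]] IH f //.
by rewrite !oddpart_recSS raddfD raddfMn /= !IH.
Qed.

(** A nonempty set has at least one block: in the recurrence [f 0] enters only with the factor
    [0 * 1]. This shields the sums from the junk value of [block_poly] at 0. *)
Lemma eq_oddpart_rec (V : nmodType) m (f g : nat -> V) :
  (forall j, f j.+1 = g j.+1) -> oddpart_rec m.+1 f = oddpart_rec m.+1 g.
Proof.
elim/ltn_ind: m f g => -[|m] IH f g fg; first exact: fg.
rewrite !oddpart_recSS (IH m _ _ (g \o succn)) // => [|j]; last exact: fg.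
by case: m IH => [|m] IH; [rewrite mul0n !mulr0n | rewrite (IH m _ f g)].
Qed.

Lemma derivative_coef (F : fieldType) (i n x y e : F) :
  i ^+ 2 = -1 -> x != 0 -> y != 0 -> n / x * (e / y) = - i * e / (x * y) * (i * n).
Proof.
(* Inserting the factor [- i ^+ 2 = 1] leaves an identity that [field] proves with [i] as an
   indeterminate. *)
move=> i2 x0 y0; transitivity (- i ^+ 2 * (n / x * (e / y))).
  by rewrite i2 opprK mul1r.
by field; rewrite x0 y0.
Qed.

Lemma block_coef (F : fieldType) (x y z e : F) :
  x != 0 -> y != 0 -> z != 0 -> - (e / z) = - e / (y * (x * z)) * (x * y).
Proof. by move=> x0 y0 z0; field; rewrite x0 y0 z0. Qed.

Local Open Scope complex_scope.

Section CotPowPoly.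
Variables (R : realType) (n : nat).

Local Notation C := R[i].

(* [d/dz] acting on polynomials in [tan z], scaled by [i n]; up to the scaling it
   sends [P_(j-1)] to [P_j], so it acts on sums over partitions as the shift
   of the number of blocks. *)
Definition tan_diff (q : {poly C}) : {poly C} :=
  ('i * n%:R) *: ((1 + 'X^2) * q^`()).

Fact tan_diff_is_additive : zmod_morphism tan_diff.
Proof. by move=> p q; rewrite /tan_diff derivB mulrBr scalerBr. Qed.
HB.instance Definition _ := GRing.isZmodMorphism.Build _ _
  tan_diff tan_diff_is_additive.

(* Junk value at [j = 0], since [0.-1 = 0]. *)
Definition block_poly (j : nat) : {poly C} :=
  ('i * n%:R) ^+ j *: map_poly (real_complex R) (derpoly R j.-1).

Lemma tan_diff_block_poly j : tan_diff (block_poly j.+1) = block_poly j.+2.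
Proof.
rewrite /tan_diff /block_poly /= derivZ -scalerAr scalerA -exprS.
by rewrite rmorphM rmorphD rmorph1 /= map_polyXn deriv_map.
Qed.

Lemma oddpart_rec_block_poly m : oddpart_rec m.+2 block_poly =
  tan_diff (oddpart_rec m.+1 block_poly)
  + oddpart_rec m block_poly *+ (m * m.+1).
Proof.
rewrite oddpart_recSS raddf_oddpart_rec; congr (_ + _).
by apply: eq_oddpart_rec => j; rewrite /= tan_diff_block_poly.
Qed.

Definition parity_term m : C := if ~~ odd m then (-1) ^+ m./2 * n%:R else 0.

Lemma parity_termSS m : parity_term m.+2 = - parity_term m.
Proof.
rewrite /parity_term /= negbK.
by case: odd; rewrite ?oppr0 // exprS mulN1r mulNr.
Qed.

Lemma expNiSS m : (- 'i : C) ^+ m.+2 = - (- 'i) ^+ m.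
Proof. by rewrite !exprS mulrA mulrNN -expr2 sqr_i mulN1r. Qed.

Lemma map_cotpow_poly m :
  map_poly (real_complex R) (cotpow_poly n m.+1) =
  (parity_term m.+1)%:P + ((- 'i) ^+ m.+1 / m`!%:R) *: oddpart_rec m.+1 block_poly.
Proof.
have nat0 k : (k.+1%:R : C) != 0 by rewrite pnatr_eq0.
have fact0 k : (k`!%:R : C) != 0 by rewrite pnatr_eq0 -lt0n fact_gt0.
(* The derivative half of the recurrence: the parity term is constant and drops out, and [n] becomes
   [(- 'i) * ('i * n)], which supplies the next power of [- 'i]. *)
have step k : map_poly (real_complex R) (cotpow_poly n k.+1) =
    (parity_term k.+1)%:P + ((- 'i) ^+ k.+1 / k`!%:R) *: oddpart_rec k.+1 block_poly ->
  map_poly (real_complex R)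
    ((n%:R / k.+1%:R) *: ((1 + 'X^2) * (cotpow_poly n k.+1)^`())) =
  ((- 'i) ^+ k.+2 / (k.+1)`!%:R) *: tan_diff (oddpart_rec k.+1 block_poly).
  have e1 : map_poly (real_complex R) (1 + 'X^2) = 1 + 'X^2.
    by rewrite rmorphD rmorph1 /= map_polyXn.
  move=> e; rewrite map_polyZ [X in _ *: X]rmorphM /= e1 -deriv_map e.
  rewrite derivD derivC add0r derivZ -scalerAr /tan_diff !scalerA.
  congr (_ *: _); rewrite fmorph_div !rmorph_nat factS natrM.
  rewrite [in RHS]exprS.
  exact: derivative_coef (sqr_i R) (nat0 k) (fact0 k).
elim/ltn_ind: m => -[|[|m]] IH.
- rewrite /cotpow_poly /parity_term /oddpart_rec /block_poly /= add0r.
  rewrite map_polyZ map_polyX divr1 !expr1 scalerA mulrA mulNr -expr2 sqr_i opprK mul1r.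
  by rewrite /= rmorph_nat.
(* Here the subtracted polynomial is the constant [n] at index 0, outside the induction hypothesis;
   it yields exactly the parity term [- n]. *)
- rewrite cotpow_polySS rmorphB /= step; last exact: IH.
  rewrite oddpart_rec_block_poly mul0n mulr0n addr0 parity_termSS addrC polyCN.
  by rewrite /cotpow_poly /parity_term /= map_polyC /= rmorph_nat mul1r.
rewrite cotpow_polySS rmorphB /= step; last exact: IH.
rewrite /= (IH m) // (oddpart_rec_block_poly m.+1) (parity_termSS m.+1) polyCN.
rewrite scalerDr opprD addrCA; congr (_ + _); congr (_ + _).
rewrite -[oddpart_rec _ _ *+ _](@scaler_nat C) scalerA -scaleNr; congr (_ *: _).
(* The factor [(m+1) * (m+2)] of the partition recurrence turns [1 / (m+2)]![into]1 / m[!]. *)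
rewrite [in RHS]expNiSS !factS !natrM.
exact: block_coef (nat0 m) (nat0 m.+1) (fact0 m).
Qed.

End CotPowPoly.

Theorem theorem6p1 (R : realType) (m n : nat) (alpha : R) :
  (1 <= m)%N -> (2 <= n)%N ->
  (forall z : int, alpha != z%:~R * pi) ->
  (\sum_(k < n) (cot ((alpha + k%:R * pi) / n%:R)) ^+ m)%:C
  = (if ~~ odd m then (-1) ^+ (m./2) * n%:R else 0)
    + (- 'i) ^+ m / (m.-1)`!%:R
      * \sum_(nu : {set {set 'I_m}} | odd_set_partition nu)
          ((derpoly R (#|nu|.-1)).[cot alpha])%:C
          * ('i * n%:R) ^+ #|nu| * mobius_part R[i] nu.
Proof.
move=> m0 n2 /sin_neq0 sa; rewrite sum_cot_pow ?(ltnW n2) //.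
case: m m0 => // m _.
rewrite -[_%:C](horner_map (real_complex R)) map_cotpow_poly hornerD hornerC hornerZ /=.
congr (_ + _ * _).
have := sum_odd_partition {poly R[i]} _ [set: 'I_m.+1] (block_poly R n).
rewrite cardsT card_ord => <-; rewrite horner_sum.
apply: eq_bigr => nu /andP[_ /forall_inP onu].
rewrite hornerMn hornerZ /block_poly horner_map /= [X in X *+ _]mulrC -mulr_natr.
(* Odd blocks make every sign [(-1) ^+ #|B|.-1] equal to 1, so the Möbius value is the product of
   the factorials. *)
congr (_ * _); rewrite /mobius_part natr_prod; apply: eq_bigr => B /onu oB.
by rewrite -signr_odd; case: #|B| oB => //= k /negbTE ->; rewrite mul1r.
Qed.
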